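(* Assume that all components of $L^{\top}x$ are nonzero. Considering in the solution space $\mathbb R^k$ the componentwise norm $$\|u\|_c=\min\{\omega:\ |u_i|\le\omega|(L^{\top}x)_i|,\ i=1,\dots,k\}=\max_{1\le i\le k}\frac{|u_i|}{|(L^{\top}x)_i|},$$ the resulting componentwise condition number $\kappa_c$ of $g(A,b)=L^{\top}(A^{\top}\Sigma_{pq}A)^{-1}A^{\top}\Sigma_{pq}b$ at $(A,b)$ has the three expressions \begin{align*} \kappa_c&=\big\|D_{L^{\top}x}^{-1}L^{\top}[\,VD_A\ \ WD_b\,]\big\|_\infty\\ &=\big\|\,|D_{L^{\top}x}^{-1}|\,\big(|L^{\top}V|\,\mathrm{vec}(|A|)+|L^{\top}W|\,|b|\big)\big\|_\infty\\ &=\Big\|\sum_{j=1}^n\big|D_{L^{\top}x}^{-1}L^{\top}(A^{\top}\Sigma_{pq}A)^{-1}\big(e_j(\Sigma_{pq}r)^{\top}-x_jA^{\top}\Sigma_{pq}\big)\big|\,|A(:,j)|+|D_{L^{\top}x}^{-1}L^{\top}W|\,|b|\,\Big\|_\infty . \end{align*}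
   Context: Let $m\ge n$, $p+q=m$, $\Sigma_{pq}=\begin{pmatrix} I_p&0\\0&-I_q\end{pmatrix}$, $A=(a_{ij})\in\mathbb R^{m\times n}$, $b\in\mathbb R^m$, with $A^{\top}\Sigma_{pq}A$ positive definite (standing assumption). Let $x=(x_1,\dots,x_n)^{\top}=(A^{\top}\Sigma_{pq}A)^{-1}A^{\top}\Sigma_{pq}b$ be the solution of the indefinite least squares problem $\min_x(b-Ax)^{\top}\Sigma_{pq}(b-Ax)$, and $r=b-Ax$. Let $L\in\mathbb R^{n\times k}$, $k\le n$, be a fixed matrix, and $g(A,b)=L^{\top}(A^{\top}\Sigma_{pq}A)^{-1}A^{\top}\Sigma_{pq}b\in\mathbb R^k$, which is Fréchet differentiable near $(A,b)$, with derivative $g'(A,b)$. On the data space the componentwise norm relative to $(A,b)$ is used: $\|(\Delta A,\Delta b)\|_c=\min\{\omega\ge0:\ |\Delta a_{ij}|\le\omega|a_{ij}|,\ |\Delta b_i|\le\omega|b_i|\ \text{for all } i,j\}$ (equal to $+\infty$ if no such $\omega$ exists). Then $\kappa_c=\max_{\|(\Delta A,\Delta b)\|_c=1}\|g'(A,b)\cdot(\Delta A,\Delta b)\|_c$, the outer norm being the componentwise norm on the solution space. Define $W=(A^{\top}\Sigma_{pq}A)^{-1}A^{\top}\Sigma_{pq}$ and $V=(A^{\top}\Sigma_{pq}A)^{-1}\otimes(\Sigma_{pq}r)^{\top}-x^{\top}\otimes W$, where $\otimes$ is the Kronecker product. $\mathrm{vec}$ stacks the columns of a matrix; $D_A=\mathrm{diag}(\mathrm{vec}(A))$;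 $D_v=\mathrm{diag}(v)$ for a vector $v$; $e_j$ is the $j$th column of $I_n$; $A(:,j)$ is the $j$th column of $A$; $|\cdot|$ of a matrix or vector is taken entrywise; $\|\cdot\|_\infty$ of a matrix is the induced infinity norm (maximum absolute row sum). *)

(* Defs.v *)
(* MathComp / MathComp-Analysis; the reals are an arbitrary R : realType. *)
From HB Require Import structures.
From mathcomp Require Import all_boot all_order all_algebra.
From mathcomp Require Import all_classical all_reals all_analysis.
Import Order.TTheory GRing.Theory Num.Theory.
Import numFieldNormedType.Exports.

Set Implicit Arguments.
Unset Strict Implicit.
Unset Printing Implicit Defensive.

Local Open Scope classical_set_scope.
Local Open Scope ring_scope.

Definition posdefmx (R : realType) (n : nat) (M : 'M[R]_n) : Prop :=
  forall v : 'cV[R]_n, v != 0 -> 0 < (v^T *m M *m v) 0 0.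

(* Entrywise absolute value; MathComp-Analysis' `|X| is the largest entry. *)
Definition absmx (R : realType) (m n : nat) (X : 'M[R]_(m, n)) : 'M[R]_(m, n) :=
  map_mx Num.norm X.

(* Operator norm induced by the sup norm, as the maximum absolute row sum. *)
Definition norm_oo (R : realType) (m n : nat) (X : 'M[R]_(m, n)) : R :=
  \big[Num.max/0]_(i < m) \sum_(j < n) `|X i j|.

Definition diagv (R : realType) (n : nat) (v : 'cV[R]_n) : 'M[R]_n :=
  diag_mx v^T.

(* mxvec is row-major, so stacking the columns of A is mxvec of A^T:
   A i j sits at position mxvec_index j i, that is j * m + i. *)
Definition vec (R : realType) (m n : nat) (A : 'M[R]_(m, n)) : 'cV[R]_(n * m) :=
  (mxvec A^T)^T.

(* The pair (i, j) such that mxvec_index i j = k. *)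
Definition mxvec_pair (m n : nat) (k : 'I_(m * n)) : 'I_m * 'I_n :=
  enum_val (cast_ord (esym (mxvec_cast m n)) k).

Lemma mxvec_pairK (m n : nat) (i : 'I_m) (j : 'I_n) :
  mxvec_pair (mxvec_index i j) = (i, j).
Proof. by rewrite /mxvec_pair /mxvec_index cast_ordK enum_rankK. Qed.

(* Kronecker product: the (i1, j1) block of size m2 x n2 is X i1 j1 *: Y. *)
Definition kron (R : realType) (m1 n1 m2 n2 : nat)
    (X : 'M[R]_(m1, n1)) (Y : 'M[R]_(m2, n2)) : 'M[R]_(m1 * m2, n1 * n2) :=
  \matrix_(k, l) (X (mxvec_pair k).1 (mxvec_pair l).1 *
                  Y (mxvec_pair k).2 (mxvec_pair l).2).

Lemma kronE (R : realType) (m1 n1 m2 n2 : nat)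
    (X : 'M[R]_(m1, n1)) (Y : 'M[R]_(m2, n2)) i1 i2 j1 j2 :
  kron X Y (mxvec_index i1 i2) (mxvec_index j1 j2) = X i1 j1 * Y i2 j2.
Proof. by rewrite mxE !mxvec_pairK. Qed.

Definition signmx (R : realType) (p q : nat) : 'M[R]_(p + q) :=
  block_mx 1%:M 0 0 (- 1%:M).
Arguments signmx R p q : clear implicits.

Definition gram (R : realType) (p q n : nat) (A : 'M[R]_(p + q, n)) : 'M[R]_n :=
  A^T *m signmx R p q *m A.

Definition ils_W (R : realType) (p q n : nat) (A : 'M[R]_(p + q, n)) :
    'M[R]_(n, p + q) :=
  invmx (gram A) *m A^T *m signmx R p q.

Definition ils_sol (R : realType) (p q n : nat)
    (A : 'M[R]_(p + q, n)) (b : 'cV[R]_(p + q)) : 'cV[R]_n :=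
  invmx (gram A) *m A^T *m signmx R p q *m b.

Definition ils_res (R : realType) (p q n : nat)
    (A : 'M[R]_(p + q, n)) (b : 'cV[R]_(p + q)) : 'cV[R]_(p + q) :=
  b - A *m ils_sol A b.

(* The casts identify n * 1 and 1 * n with n. *)
Definition ils_V (R : realType) (p q n : nat)
    (A : 'M[R]_(p + q, n)) (b : 'cV[R]_(p + q)) : 'M[R]_(n, n * (p + q)) :=
  castmx (muln1 n, erefl)
    (kron (invmx (gram A)) (signmx R p q *m ils_res A b)^T)
  - castmx (mul1n n, erefl) (kron (ils_sol A b)^T (ils_W A)).

Definition ils_map (R : realType) (p q n k : nat) (L : 'M[R]_(n, k))
    (z : 'M[R]_(p + q, n) * 'cV[R]_(p + q)) : 'cV[R]_k :=
  L^T *m ils_sol z.1 z.2.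

Definition comp_le (R : realType) (m n : nat) (w : R) (X dX : 'M[R]_(m, n)) :
    Prop :=
  forall i j, `|dX i j| <= w * `|X i j|.

(* Componentwise norms relative to a datum.  The set of admissible w is closed,
   so the infimum is a minimum as soon as that set is nonempty; it is +oo
   otherwise. *)
Definition cnorm (R : realType) (k : nat) (y u : 'cV[R]_k) : \bar R :=
  ereal_inf [set w%:E | w in [set w : R | 0 <= w /\ comp_le w y u]].

Definition cnorm2 (R : realType) (m n : nat)
    (z dz : 'M[R]_(m, n) * 'cV[R]_m) : \bar R :=
  ereal_inf [set w%:E | w in
    [set w : R | [/\ 0 <= w, comp_le w z.1 dz.1 & comp_le w z.2 dz.2]]].

(* 'd g z is the Frechet derivative of g at z. *)
Definition cond_c (R : realType) (m n k : nat)
    (g : 'M[R]_(m, n) * 'cV[R]_m -> 'cV[R]_k) (z : 'M[R]_(m, n) * 'cV[R]_m) :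
    \bar R :=
  ereal_sup [set cnorm (g z) ('d g z dz) | dz in [set dz | cnorm2 z dz = 1%E]].

(* Main.v *)
Require Import Defs.
From HB Require Import structures.
From mathcomp Require Import all_boot all_order all_algebra.
From mathcomp Require Import perm.
From mathcomp Require Import all_classical all_reals all_analysis.
Import Order.TTheory GRing.Theory Num.Theory.
Import numFieldNormedType.Exports.
Local Open Scope classical_set_scope.
Local Open Scope ring_scope.

(* Differentiating the normal equation (A^T S A) x = A^T S b gives
     dx = (A^T S A)^-1 dA^T S r - W dA x + W db = V vec(dA) + W db,
   so each component of the derivative of g is an explicit linear form in the
   entries of (dA, db).  On the box |dA| <= |A|, |db| <= |b| a linear form has
   maximum the l1 norm of its coefficients weighted by the data, attained at a
   choice of signs; the three expressions are three ways to write the largest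
   of these maxima divided by |(L^T x)_i|. *)

Set Implicit Arguments.
Unset Strict Implicit.
Unset Printing Implicit Defensive.

(** * Differentiability of matrix-valued maps *)

(** A derivative depends only on the germ of the map. This serves twice: to replace [invmx] by the
    adjugate formula, and to differentiate the normal equation, which holds only near the datum. *)
Lemma near_eq_is_diff (R : numFieldType) (V W : normedModType R)
    (f g df : V -> W) (x : V) :
  (\near x, f x = g x) -> is_diff x f df -> is_diff x g df.
Proof.
move=> fg [dfx <-].
(* The little-o estimate for [f] carries over to [g], since the two agree at [x] and at [z + x] for
   [z] near 0. *)
have gx : g \o shift x = cst (g x) + 'd f x +o_ 0 id.
  apply/eqaddoP => e e0.
  have /diff_locally/eqaddoP/(_ e e0) := dfx.
  have : \forall z \near 0, f (z + x) = g (z + x).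
    by move: fg; rewrite (near_shift 0) subr0.
  apply: filter_app2; near=> z => fgz /=.
  by rewrite !fctE /= fgz (nbhs_singleton fg).
have dgE : 'd g x = 'd f x :> (V -> W).
  by apply: diff_unique => //; exact: diff_continuous.
apply: DiffDef => //; apply/diff_locallyP; rewrite dgE; split => //.
exact: diff_continuous.
Unshelve. all: by end_near. Qed.

Section matrix_diff.
Variables (R : realType) (V : normedModType R).

(** A matrix is a finite sum of its coordinates times the constant matrices [delta_mx i j], so
    everything reduces to scalar functions. *)
Lemma differentiable_mxP (m n : nat) (M : V -> 'M[R]_(m, n)) (x : V) :
  differentiable M x <-> forall i j, differentiable (fun z => M z i j) x.
Proof.
split=> [dM i j|dM].
  exact: (differentiable_comp dM (differentiable_coord _ i j)).
have -> : M = \sum_(i < m) \sum_(j < n) (fun z => M z i j *: delta_mx i j).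
  apply/funext => z; rewrite [LHS]matrix_sum_delta fct_sumE.
  by apply: eq_bigr => i _; rewrite fct_sumE.
by do 2 (apply: differentiable_sum => ?); exact: differentiableZl.
Qed.

Lemma differentiable_mulmx (m n p : nat) (F : V -> 'M[R]_(m, n))
    (G : V -> 'M[R]_(n, p)) (x : V) :
  differentiable F x -> differentiable G x ->
  differentiable (fun z => F z *m G z) x.
Proof.
move=> /differentiable_mxP dF /differentiable_mxP dG.
apply/differentiable_mxP => i j.
rewrite (_ : (fun z => _) = \sum_k (fun z => F z i k) * (fun z => G z k j)).
  by apply: differentiable_sum => k; exact: differentiableM.
by apply/funext => z; rewrite mxE fct_sumE.
Qed.

(** By the Leibniz formula the determinant is a polynomial in the entries. *)
Lemma differentiable_det (n : nat) (F : V -> 'M[R]_n) (x : V) :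
  differentiable F x -> differentiable (fun z => \det (F z)) x.
Proof.
move=> /differentiable_mxP dF.
rewrite (_ : (fun z => _) = \sum_(s : 'S_n)
  (fun z => (-1) ^+ s * \prod_i F z i (s i))); last first.
  by apply/funext => z; rewrite fct_sumE.
elim/big_ind : _ => [|f g df dg|s _]; first exact: (differentiable_cst 0).
  exact: differentiableD.
apply: (@differentiableM _ _ (cst _)); first exact: differentiable_cst.
rewrite (_ : (fun z => _) = \prod_i (fun z => F z i (s i))); last first.
  by apply/funext => z; rewrite fct_prodE.
elim/big_ind : _ => [|f g df dg|i _ //].
  exact: (@differentiable_cst R V R 1 x).
exact: differentiableM.
Qed.

Lemma differentiable_adj (n : nat) (F : V -> 'M[R]_n) (x : V) :
  differentiable F x -> differentiable (fun z => \adj (F z)) x.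
Proof.
move=> /differentiable_mxP dF; apply/differentiable_mxP => i j.
rewrite (_ : (fun z => _) =
  fun z => (-1) ^+ (j + i) * \det (row' j (col' i (F z)))); last first.
  by apply/funext => z; rewrite mxE.
apply: (@differentiableM _ _ (cst _)); first exact: differentiable_cst.
apply: differentiable_det; apply/differentiable_mxP => a b.
rewrite (_ : (fun z => _) = fun z => F z (lift j a) (lift i b)) //.
by apply/funext => z; rewrite !mxE.
Qed.

Lemma near_unitmx (n : nat) (F : V -> 'M[R]_n) (x : V) :
  differentiable F x -> F x \in unitmx -> \forall z \near x, F z \in unitmx.
Proof.
move=> /differentiable_det/differentiable_continuous dF Fx.
near=> z; rewrite unitmxE unitfE; near: z.
by apply: (cvgr_neq0 _ dF); rewrite -unitfE -unitmxE.
Unshelve. all: by end_near. Qed.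

(** [invmx] equals the adjugate over the determinant only at invertible matrices and returns its
    argument elsewhere; the two are therefore compared only near [x], where invertibility
    persists. *)
Lemma differentiable_invmx (n : nat) (F : V -> 'M[R]_n) (x : V) :
  differentiable F x -> F x \in unitmx ->
  differentiable (fun z => invmx (F z)) x.
Proof.
move=> dF Fx; pose G z := (\det (F z))^-1 *: \adj (F z).
have dG : differentiable G x.
  have /differentiable_mxP dadj := differentiable_adj dF.
  apply/differentiable_mxP => i j.
  rewrite (_ : (fun z => _) =
    (fun z => (\det (F z))^-1) * (fun z => (\adj (F z)) i j)); last first.
    by apply/funext => z; rewrite mxE.
  apply: differentiableM => //.
  apply: differentiableV; first exact: differentiable_det.
  by rewrite -unitfE -unitmxE.
have GF : \forall z \near x, G z = invmx (F z).
  by near do rewrite /invmx ifT//; exact: near_unitmx.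
by have [] := near_eq_is_diff GF (differentiableP dG).
Unshelve. all: by end_near. Qed.

End matrix_diff.

(** * Derivatives of linear maps and of matrix products *)

Lemma is_diff_linear (R : numFieldType) (V W : normedModType R)
    (f : {linear V -> W}) (x : V) :
  continuous f -> is_diff x f f.
Proof.
by move=> cf; apply: DiffDef; [exact: linear_differentiable|exact: diff_lin].
Qed.

Lemma is_diff_fst (R : numFieldType) (V W : normedModType R) (x : V * W) :
  is_diff x fst fst.
Proof.
apply: (@is_diff_linear _ _ _ (fst : {linear (V * W)%type -> V})).
by move=> ?; exact: cvg_fst.
Qed.

Lemma is_diff_snd (R : numFieldType) (V W : normedModType R) (x : V * W) :
  is_diff x snd snd.
Proof.
apply: (@is_diff_linear _ _ _ (snd : {linear (V * W)%type -> W})).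
by move=> ?; exact: cvg_snd.
Qed.

Lemma is_diff_trmx (R : realType) (V : normedModType R) (m n : nat)
    (F dF : V -> 'M[R]_(m, n)) (x : V) :
  is_diff x F dF -> is_diff x (fun z => (F z)^T) (fun h => (dF h)^T).
Proof.
move=> dFx; have c : continuous (@trmx R m n).
  move=> A; apply: differentiable_continuous; apply/differentiable_mxP => i j.
  rewrite (_ : (fun z => _) = fun z : 'M[R]_(m, n) => z j i).
    exact: differentiable_coord.
  by apply/funext => z; rewrite mxE.
apply: (@is_diff_comp R V _ _ F dF trmx trmx) => //.
exact: (@is_diff_linear _ _ _ (trmx : {linear 'M[R]_(m, n) -> 'M[R]_(n, m)})).
Qed.

Lemma is_diff_mulmx (R : realType) (V : normedModType R) (m n p : nat)
    (F dF : V -> 'M[R]_(m, n)) (G dG : V -> 'M[R]_(n, p)) (x : V) :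
  is_diff x F dF -> is_diff x G dG ->
  is_diff x (fun z => F z *m G z) (fun h => F x *m dG h + dF h *m G x).
Proof.
move=> [dFx <-] [dGx <-]; apply: DiffDef; first exact: differentiable_mulmx.
(* The rule for bilinear maps asks for joint continuity of the product, which its differentiability
   in coordinates supplies. *)
have cM : continuous (fun q : 'M[R]_(m, n) * 'M[R]_(n, p) => q.1 *m q.2).
  move=> q; apply: differentiable_continuous; apply: differentiable_mulmx.
    by case: (is_diff_fst q).
  by case: (is_diff_snd q).
rewrite (_ : (fun z => _) = (fun q => q.1 *m q.2) \o (fun z => (F z, G z)))//.
pose f : {bilinear 'M[R]_(m, n) -> 'M[R]_(n, p) -> 'M[R]_(m, p)} := mulmx.
rewrite diff_comp; first last.
- exact: (@differentiable_bilin _ _ _ _ f).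
- exact: differentiable_pair.
by rewrite (@diff_bilin _ _ _ _ f)//= diff_pair.
Qed.

(** * Derivative of the indefinite least squares solution *)

Lemma posdefmx_unit (R : realType) (n : nat) (M : 'M[R]_n) :
  posdefmx M -> M \in unitmx.
Proof.
move=> Mpd; rewrite -unitmx_tr -row_free_unit -kermx_eq0.
(* A nonzero [v] with [v *m M^T = 0] gives [M *m v^T = 0], so the quadratic form would vanish at
   [v^T]. *)
apply: contraT => /rowV0Pn[v] /sub_kermxP vM v0.
have := Mpd v^T; rewrite trmxK trmx_eq0 => /(_ v0).
by rewrite -mulmxA -[M *m _]trmxK trmx_mul trmxK vM trmx0 mulmx0 mxE ltxx.
Qed.

Lemma is_diff_ils_sol (R : realType) (p q n : nat) (A : 'M[R]_(p + q, n))
    (b : 'cV[R]_(p + q)) : gram A \in unitmx ->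
  is_diff (A, b) (fun z => ils_sol z.1 z.2)
    (fun h => invmx (gram A) *m h.1^T *m (signmx R p q *m ils_res A b)
              - ils_W A *m h.1 *m ils_sol A b + ils_W A *m h.2).
Proof.
move=> gA; set S := signmx R p q.
have d1 := is_diff_fst (A, b); have d2 := is_diff_snd (A, b).
have dT := is_diff_trmx d1.
have dTS := is_diff_mulmx dT (is_diff_cst S (A, b)).
pose D := ('M[R]_(p + q, n) * 'cV[R]_(p + q))%type.
pose G (z : D) := gram z.1.
pose c (z : D) := z.1^T *m S *m z.2.
pose x (z : D) := ils_sol z.1 z.2.
have [dG dGE] := is_diff_mulmx dTS d1 : is_diff (A, b) G _.
have [dc dcE] := is_diff_mulmx dTS d2 : is_diff (A, b) c _.
have uG : G (A, b) \in unitmx by [].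
(* The closed formula only shows that the derivative of [x] exists; its value is then read off by
   implicit differentiation of [G z *m x z = c z]. *)
have dx : differentiable x (A, b).
  rewrite (_ : x = fun z => invmx (G z) *m c z).
    by apply: differentiable_mulmx => //; exact: differentiable_invmx.
  by apply/funext => z; rewrite /x /ils_sol /c !mulmxA.
have [dGx dGxE] := is_diff_mulmx (differentiableP dG) (differentiableP dx).
(* The inverse cancels only where the Gram matrix is invertible, hence the restriction to a
   neighbourhood. *)
have Gx : \forall z \near (A, b), G z *m x z = c z.
  apply: filterS (near_unitmx dG uG) => z; rewrite /x /c /G /ils_sol.
  by move: (gram z.1) => M uM; rewrite -!mulmxA mulKVmx.
have [_ E0] := near_eq_is_diff Gx (differentiableP dGx).
have E1 := etrans (esym dcE) (etrans E0 dGxE).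
apply: DiffDef; [exact: dx|apply/funext => h].
have E2 := congr1 (fun f => f h) dGE.
have := congr1 (fun f => f h) E1.
rewrite /= {}E2 /= mulmx0 !add0r => E.
(* The product rule gives [dc = G dx + dG x]; solving for [G dx] and multiplying by the inverse Gram
   matrix isolates [dx]. *)
transitivity (invmx (gram A) *m (G (A, b) *m 'd x (A, b) h)).
  exact: esym (mulKmx uG _).
rewrite (canRL (addrK _) (esym E)).
rewrite /x /= /ils_res /ils_W -/S.
move: (ils_sol A b) => v.
rewrite !(mulmxDr, mulmxDl, mulmxBr, mulmxN, mulNmx) !mulmxA.
rewrite [RHS]addrC !addrA.
by rewrite opprD addrA addrAC.
Qed.

(** * Positions of vectorized entries *)

Lemma index_pair_prod (S T : eqType) (s : seq S) (t : seq T) x y :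
  x \in s -> y \in t ->
  index (x, y) [seq (u, v) | u <- s, v <- t] =
  (index x s * size t + index y t)%N.
Proof.
move=> xs yt; elim: s xs => // u s IHs; rewrite inE /= index_cat size_map.
have [-> _|ux /= xs] := eqVneq x u.
  by rewrite mem_map ?yt ?index_map// => ? ? [].
rewrite ifN; last by apply/mapP => -[v _ [/eqP]]; rewrite (negPf ux).
by rewrite IHs// mulSn addnA.
Qed.

Lemma enum_rankE (T : finType) (x : T) : enum_rank x = index x (enum T) :> nat.
Proof.
by rewrite -[in RHS](nth_enum_rank x x) index_uniq ?enum_uniq// -cardE.
Qed.

(** This numerical form resolves the casts from [n * 1] and [1 * n] to [n] in [ils_V]. *)
Lemma mxvec_indexE m n (i : 'I_m) (j : 'I_n) :
  mxvec_index i j = (i * n + j)%N :> nat.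
Proof.
rewrite /= enum_rankE enumT unlock /= index_pair_prod ?mem_enum//.
by rewrite size_enum_ord !index_enum_ord.
Qed.

Lemma sum_mxvec_index (V : nmodType) m n (F : 'I_(m * n) -> V) :
  \sum_l F l = \sum_i \sum_j F (mxvec_index i j).
Proof.
rewrite pair_bigA (reindex _ (curry_mxvec_bij m n)) /=.
by apply: eq_bigr => -[].
Qed.

(** * Componentwise norms and the maximum of a linear map *)

Section cnorm.
Variable R : realType.

(** The largest ratio is itself admissible, and every admissible [w] bounds each ratio. *)
Lemma cnormE k (y u : 'cV[R]_k) : (forall i, y i 0 != 0) ->
  cnorm y u = (\big[Num.max/0]_(i < k) (`|u i 0| / `|y i 0|))%:E.
Proof.
move=> y0; have y_gt0 i : 0 < `|y i 0| by rewrite normr_gt0.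
apply/le_anti/andP; split.
  apply: ereal_inf_lbound.
  exists (\big[Num.max/0]_(i < k) (`|u i 0| / `|y i 0|)) => //.
  split; first exact: bigmax_ge_id.
  move=> i j; rewrite (ord1 j) -ler_pdivrMr//.
  exact: (le_bigmax _ (fun i => `|u i 0| / `|y i 0|)).
apply: le_ereal_inf_tmp => _ [w [w0 yuw] <-]; rewrite lee_fin.
by apply: bigmax_le => // i _; rewrite ler_pdivrMr.
Qed.

Variables m n : nat.
Implicit Types z dz : 'M[R]_(m, n) * 'cV[R]_m.

(** The infimum is attained: [1 + e] dominates for every [e > 0], and the inequalities survive the
    limit. *)
Lemma cnorm2_eq1 z dz : cnorm2 z dz = 1%E ->
  comp_le 1 z.1 dz.1 /\ comp_le 1 z.2 dz.2.
Proof.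
move=> zdz.
have H (e : R) : 0 < e -> comp_le (1 + e) z.1 dz.1 /\ comp_le (1 + e) z.2 dz.2.
  move=> e0; have : (cnorm2 z dz < (1 + e)%:E)%E by rewrite zdz lte_fin ltrDl.
  move=> /ereal_inf_lt[_ [w [_ w1 w2] <-]]; rewrite lte_fin => /ltW we.
  by split=> i j; [apply: le_trans (w1 i j) _|apply: le_trans (w2 i j) _];
    rewrite ler_wpM2r.
have lim (a b : R) :
    0 <= b -> (forall e, 0 < e -> a <= (1 + e) * b) -> a <= 1 * b.
  move=> b0 ab; rewrite mul1r; apply/ler_addgt0Pr => e e0.
  (* The choice [e / (b + 1)] makes the excess at most [e], and the denominator is positive even
     when [b = 0]. *)
  have b1 : 0 < b + 1 by rewrite ltr_wpDl.
  apply: (le_trans (ab _ (divr_gt0 e0 b1))); rewrite mulrDl mul1r lerD2l.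
  by rewrite mulrAC ler_pdivrMr// ler_pM2l// lerDl.
by split=> i j; apply: lim => // e /H[].
Qed.

(** The value 1 is admissible, and a single nonzero entry of [z.1] forces every admissible [w] to be
    at least 1. *)
Lemma cnorm2_norm_eq z dz : z.1 != 0 ->
  (forall i j, `|dz.1 i j| = `|z.1 i j|) ->
  (forall i j, `|dz.2 i j| = `|z.2 i j|) -> cnorm2 z dz = 1%E.
Proof.
move=> z0 dz1 dz2; apply/le_anti/andP; split.
  apply: ereal_inf_lbound; exists 1 => //.
  by split=> // i j; rewrite mul1r ?dz1 ?dz2.
apply: le_ereal_inf_tmp => _ [w [w0 + _] <-]; rewrite lee_fin => w1.
have [i [j zij]] : exists i j, z.1 i j != 0.
  apply: contra_notP (negP z0) => /forallNP z0'.
  apply/eqP/matrixP => i j; rewrite mxE; apply/eqP.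
  by have /forallNP/(_ j)/negP := z0' i; rewrite negbK.
by have := w1 i j; rewrite dz1 -ler_pdivrMr ?normr_gt0// divff// normr_eq0.
Qed.

Variables (k : nat) (y : 'cV[R]_k).
Variables (P : 'I_k -> 'M[R]_(m, n)) (Q : 'M[R]_(k, m)).
Variable D : 'M[R]_(m, n) * 'cV[R]_m -> 'cV[R]_k.
Hypothesis DE : forall dz i,
  D dz i 0 = \sum_j \sum_a P i a j * dz.1 a j + \sum_a Q i a * dz.2 a 0.
Variable z : 'M[R]_(m, n) * 'cV[R]_m.

(** The l1 norm of the coefficients of component [i], weighted by the data: the bound for that
    component over perturbations of norm 1. *)
Let B i := \sum_j \sum_a `|P i a j| * `|z.1 a j| + \sum_a `|Q i a| * `|z.2 a 0|.

Lemma sup_cnorm_linear : z.1 != 0 -> (forall i, y i 0 != 0) ->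
  let K :=
    ereal_sup [set cnorm y (D dz) | dz in [set dz | cnorm2 z dz = 1%E]] in
  K = (\big[Num.max/0]_(i < k) (B i / `|y i 0|))%:E /\
  exists dz, cnorm2 z dz = 1%E /\ cnorm y (D dz) = K.
Proof.
move=> z0 y0 K.
have y_gt0 i : 0 < `|y i 0| by rewrite normr_gt0.
have DB dz i : cnorm2 z dz = 1%E -> `|D dz i 0| <= B i.
  move=> /cnorm2_eq1[dz1 dz2]; rewrite DE.
  apply: le_trans (ler_normD _ _) _; apply: lerD.
    apply: le_trans (ler_norm_sum _ _ _) _; apply: ler_sum => j _.
    apply: le_trans (ler_norm_sum _ _ _) _; apply: ler_sum => a _.
    by rewrite normrM ler_wpM2l// (le_trans (dz1 a j))// mul1r.
  apply: le_trans (ler_norm_sum _ _ _) _; apply: ler_sum => a _.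
  by rewrite normrM ler_wpM2l// (le_trans (dz2 a 0))// mul1r.
have KB dz : cnorm2 z dz = 1%E ->
    (cnorm y (D dz) <= (\big[Num.max/0]_(i < k) (B i / `|y i 0|))%:E)%E.
  move=> dz1; rewrite cnormE// lee_fin; apply: le_bigmax2 => i _.
  by rewrite ler_pM2r ?invr_gt0// DB.
have [dz dz1 dzB] : exists2 dz, cnorm2 z dz = 1%E &
    cnorm y (D dz) = (\big[Num.max/0]_(i < k) (B i / `|y i 0|))%:E.
  (* For [k = 0] there is no maximizing component; both maxima are empty, hence 0, and [z] itself
     has norm 1. *)
  have [i0 _|k0] := pickP (fun _ : 'I_k => true); last first.
    exists z; first exact: cnorm2_norm_eq.
    by rewrite cnormE// !big_pred0.
  (* The maximum starts from 0, so nonnegativity of the terms ensures that it is attained at an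
     index. *)
  have B_ge0 i : 0 <= B i / `|y i 0|.
    rewrite divr_ge0//; apply: addr_ge0; apply: sumr_ge0 => j _.
      by apply: sumr_ge0 => a _; exact: mulr_ge0.
    exact: mulr_ge0.
  have [i _ Bi] := eq_bigmax i0 (fun=> true) (fun i => B i / `|y i 0|)
    isT (fun i _ => B_ge0 i).
  (* Each entry takes the size of the datum and the sign of its coefficient in component [i], so no
     cancellation occurs there. *)
  pose dz : 'M[R]_(m, n) * 'cV[R]_m :=
    (\matrix_(a, j) ((-1) ^+ (P i a j < 0)%R * `|z.1 a j|),
     \matrix_(a, j) ((-1) ^+ (Q i a < 0)%R * `|z.2 a j|)).
  have dz1 : cnorm2 z dz = 1%E.
    apply: cnorm2_norm_eq => // a j;
      by rewrite mxE normrM normr_sign mul1r normr_id.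
  exists dz => //; apply/le_anti; rewrite KB//= Bi cnormE// lee_fin.
  rewrite (_ : B i = `|D dz i 0|).
    exact: (le_bigmax _ (fun i => `|D dz i 0| / `|y i 0|)).
  rewrite DE.
  rewrite (_ : \sum_j \sum_a _ + _ = B i).
    rewrite ger0_norm//; have := B_ge0 i.
    by rewrite pmulr_lge0 ?invr_gt0.
  congr (_ + _); last first.
    apply: eq_bigr => a _.
    by rewrite mxE mulrA [_ * (-1) ^+ _]mulrC -normrEsign.
  apply: eq_bigr => j _; apply: eq_bigr => a _.
  by rewrite mxE mulrA [_ * (-1) ^+ _]mulrC -normrEsign.
have KE : K = (\big[Num.max/0]_(i < k) (B i / `|y i 0|))%:E.
  apply/le_anti/andP; split.
    by apply: ge_ereal_sup => _ [e e1 <-]; exact: KB.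
  by rewrite -dzB; apply: ereal_sup_ubound; exists dz.
by split => //; exists dz; rewrite KE.
Qed.

End cnorm.

(** * Derivative of g and entries of V *)

Lemma is_diff_ils_map (R : realType) (p q n k : nat) (L : 'M[R]_(n, k))
    (A : 'M[R]_(p + q, n)) (b : 'cV[R]_(p + q)) : gram A \in unitmx ->
  is_diff (A, b) (ils_map (q := q) L)
    (fun h => L^T *m (invmx (gram A) *m h.1^T *m (signmx R p q *m ils_res A b)
              - ils_W A *m h.1 *m ils_sol A b + ils_W A *m h.2)).
Proof.
move=> gA.
apply: is_diff_eq (is_diff_mulmx (is_diff_cst L^T _) (is_diff_ils_sol b gA)) _.
by apply/funext => h; rewrite mul0mx addr0.
Qed.

Section ils_entries.
Variables (R : realType) (p q n : nat).
Implicit Types (A : 'M[R]_(p + q, n)) (b : 'cV[R]_(p + q)).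

Lemma ils_VE A b i j a : ils_V A b i (mxvec_index j a) =
  invmx (gram A) i j * (signmx R p q *m ils_res A b) a 0
  - ils_sol A b j 0 * ils_W A i a.
Proof.
rewrite [LHS]mxE [X in _ + X]mxE !castmxE /= !cast_ord_id.
have -> : cast_ord (esym (muln1 n)) i = mxvec_index i ord0.
  by apply: ord_inj; rewrite mxvec_indexE /= muln1 addn0.
have -> : cast_ord (esym (mul1n n)) i = mxvec_index ord0 i.
  by apply: ord_inj; rewrite mxvec_indexE.
by rewrite !kronE !mxE.
Qed.

Lemma vecE (dA : 'M[R]_(p + q, n)) j a : vec dA (mxvec_index j a) 0 = dA a j.
Proof. by rewrite mxE mxvecE mxE. Qed.

Lemma ils_V_vec A b (dA : 'M[R]_(p + q, n)) :
  ils_V A b *m vec dA =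
  invmx (gram A) *m dA^T *m (signmx R p q *m ils_res A b)
  - ils_W A *m dA *m ils_sol A b.
Proof.
apply/colP => i; rewrite [LHS]mxE sum_mxvec_index [RHS]mxE [X in _ + X]mxE.
set w := signmx R p q *m _; set x := ils_sol A b.
have -> : (invmx (gram A) *m dA^T *m w) i 0 =
    \sum_j \sum_a invmx (gram A) i j * w a 0 * dA a j.
  rewrite -mulmxA mxE; apply: eq_bigr => j _; rewrite mxE mulr_sumr.
  by apply: eq_bigr => a _; rewrite mxE mulrA mulrAC.
have -> : (ils_W A *m dA *m x) i 0 =
    \sum_j \sum_a x j 0 * ils_W A i a * dA a j.
  rewrite mxE; apply: eq_bigr => j _; rewrite mxE mulr_suml.
  by apply: eq_bigr => a _; rewrite mulrC mulrA.
rewrite -sumrB; apply: eq_bigr => j _; rewrite -sumrB.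
by apply: eq_bigr => a _; rewrite ils_VE vecE mulrBl.
Qed.

(** Since [e_j] selects column [j] of the inverse Gram matrix, the j-th matrix of the third
    expression, before scaling, is the j-th block of [p + q] columns of V. *)
Lemma ils_V_blockE A b i j a :
  (invmx (gram A) *m (col j 1%:M *m (signmx R p q *m ils_res A b)^T
    - ils_sol A b j 0 *: (A^T *m signmx R p q))) i a =
  ils_V A b i (mxvec_index j a).
Proof.
rewrite ils_VE mulmxBr mulmxA colE mul1mx -colE -scalemxAr mulmxA mxE.
rewrite [in X in X + _]mxE big_ord1 [col _ _ _ _]mxE [_^T _ _]mxE.
by rewrite [X in _ + X]mxE [X in - X]mxE.
Qed.

End ils_entries.

(** * Diagonal scaling and the three expressions *)

Lemma absmxE (R : realType) m n (X : 'M[R]_(m, n)) i j : absmx X i j = `|X i j|.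
Proof. by rewrite mxE. Qed.

Lemma mulmx_diagvE (R : realType) m n (X : 'M[R]_(m, n)) (v : 'cV[R]_n) i j :
  (X *m diagv v) i j = X i j * v j 0.
Proof. by rewrite mul_mx_diag !mxE. Qed.

Lemma invmx_diagv (R : realType) k (y : 'cV[R]_k) : (forall i, y i 0 != 0) ->
  invmx (diagv y) = diag_mx (\row_i (y i 0)^-1).
Proof.
move=> y0; have yV : diagv y *m diag_mx (\row_i (y i 0)^-1) = 1%:M.
  rewrite /diagv mulmx_diag -diag_const_mx; congr diag_mx.
  by apply/rowP => i; rewrite !mxE divff.
have [yU _] := mulmx1_unit yV.
by rewrite -[LHS]mulmx1 -yV mulKmx.
Qed.

Theorem corollary4 (R : realType) (p q n k : nat)
    (n_gt0 : (0 < n)%N) (le_n_m : (n <= p + q)%N) (le_k_n : (k <= n)%N)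
    (A : 'M[R]_(p + q, n)) (b : 'cV[R]_(p + q)) (L : 'M[R]_(n, k))
    (A_pd : posdefmx (A^T *m signmx R p q *m A))
    (Lx_neq0 : forall i : 'I_k, (L^T *m ils_sol A b) i 0 != 0) :
  let S := signmx R p q in
  let Minv := invmx (A^T *m S *m A) in
  let x := ils_sol A b in
  let r := ils_res A b in
  let W := ils_W A in
  let V := ils_V A b in
  let y := L^T *m x in
  let Dy1 := invmx (diagv y) in
  let g := @ils_map R p q n k L in
  let kappa := cond_c g (A, b) in
  [/\ (forall u : 'cV[R]_k,
         cnorm y u = (\big[Num.max/0]_(i < k) (`|u i 0| / `|y i 0|))%:E),
      differentiable g (A, b)
      /\ (exists dz : 'M[R]_(p + q, n) * 'cV[R]_(p + q),
            cnorm2 (A, b) dz = 1%E /\ cnorm y ('d g (A, b) dz) = kappa),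
      kappa = (norm_oo (Dy1 *m L^T *m
                 row_mx (V *m diagv (vec A)) (W *m diagv b)))%:E,
      kappa = (norm_oo (absmx Dy1 *m
                 (absmx (L^T *m V) *m vec (absmx A)
                  + absmx (L^T *m W) *m absmx b)))%:E &
      kappa = (norm_oo
                 (\sum_(j < n)
                    absmx (Dy1 *m L^T *m Minv *m
                           (col j 1%:M *m (S *m r)^T - x j 0 *: (A^T *m S)))
                    *m absmx (col j A)
                  + absmx (Dy1 *m L^T *m W) *m absmx b))%:E].
Proof.
move=> S Minv x r W V y Dy1 g kappa.
have gA : gram A \in unitmx := posdefmx_unit A_pd.
(* A zero [A] has zero Gram matrix, singular because [n > 0]; the determinant of an empty matrix
   would be 1. *)
have A0 : A != 0.
  apply: contraTneq gA => A0; rewrite /gram A0 mulmx0 unitmxE.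
  by rewrite -(prednK n_gt0) det0 unitr0.
have [dg dgE] := is_diff_ils_map L b gA.
(* Row [i] of [L^T *m V] is folded back into the shape of [A], so that its entries pair with those
   of the perturbation. *)
pose P i : 'M[R]_(p + q, n) := \matrix_(a, j) (L^T *m V) i (mxvec_index j a).
pose Q := L^T *m W.
have DE dz i : 'd g (A, b) dz i 0 =
    \sum_j \sum_a P i a j * dz.1 a j + \sum_a Q i a * dz.2 a 0.
  rewrite (congr1 (fun f => f dz) dgE) -ils_V_vec.
  rewrite mulmxDr (mulmxA _ V) (mulmxA _ W).
  rewrite [LHS]mxE [in X in X + _]mxE [in X in _ + X]mxE sum_mxvec_index.
  congr (_ + _) => //.
  apply: eq_bigr => j _; apply: eq_bigr => a _.
  by rewrite vecE [P i a j]mxE.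
have [kE kdz] := @sup_cnorm_linear R _ _ k y P Q _ DE (A, b) A0 Lx_neq0.
pose N i := \sum_j \sum_a `|P i a j| * `|A a j| + \sum_a `|Q i a| * `|b a 0|.
have {}kE : kappa = (\big[Num.max/0]_(i < k) (N i / `|y i 0|))%:E by exact: kE.
have Dy1E : Dy1 = diag_mx (\row_i (y i 0)^-1) := invmx_diagv Lx_neq0.
have Dy1M c (X : 'M[R]_(k, c)) i j : (Dy1 *m X) i j = (y i 0)^-1 * X i j.
  by rewrite Dy1E mul_diag_mx !mxE.
have N_ge0 i : 0 <= N i.
  apply: addr_ge0; apply: sumr_ge0 => j _; last exact: mulr_ge0.
  by apply: sumr_ge0 => a _; exact: mulr_ge0.
split; first by move=> u; exact: cnormE.
- by split.
(* First expression: the absolute row sum splits into the V columns, weighted by [vec A], and the W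
   columns, weighted by [b]. *)
- rewrite kE; congr _%:E; apply: eq_bigr => i _.
  rewrite -(mulmxA Dy1) mul_mx_row (mulmxA _ V) (mulmxA _ W).
  rewrite big_split_ord /= mulrC mulrDr; congr (_ + _).
    rewrite sum_mxvec_index mulr_sumr; apply: eq_bigr => j _.
    rewrite mulr_sumr; apply: eq_bigr => a _.
    rewrite Dy1M row_mxEl mulmx_diagvE vecE.
    by rewrite !normrM normfV [P i a j]mxE.
  rewrite mulr_sumr; apply: eq_bigr => a _.
  rewrite Dy1M row_mxEr mulmx_diagvE.
  by rewrite !normrM normfV.
(* Second expression: for a single column the row sum has one term, whose outer absolute value is
   harmless by nonnegativity. *)
- rewrite kE; congr _%:E; apply: eq_bigr => i _.
  have -> : absmx Dy1 = diag_mx (\row_i `|y i 0|^-1).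
    by apply/matrixP => i1 i2; rewrite Dy1E !mxE normrMn normfV.
  rewrite big_ord1 mul_diag_mx [in RHS]mxE [(\row_i1 _) _ _]mxE.
  rewrite mulrC normrM normfV normr_id; congr (_ * _).
  rewrite -[LHS]ger0_norm//; congr Num.norm.
  rewrite [RHS]mxE [in X in X + _]mxE [in X in _ + X]mxE sum_mxvec_index.
  congr (_ + _).
    apply: eq_bigr => j _; apply: eq_bigr => a _.
    by rewrite vecE !absmxE [P i a j]mxE.
  by apply: eq_bigr => a _; rewrite !absmxE.
(* Third expression: the sum over pairs is grouped by the column [j] of [A], each group using one
   block of V. *)
- rewrite kE; congr _%:E; apply: eq_bigr => i _.
  rewrite big_ord1 -[LHS]ger0_norm ?divr_ge0//; congr Num.norm.
  rewrite [RHS]mxE summxE mulrC mulrDr mulr_sumr; congr (_ + _).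
    apply: eq_bigr => j _; rewrite mulr_sumr [RHS]mxE; apply: eq_bigr => a _.
    rewrite !absmxE [col _ _ _ _]mxE -(mulmxA _ Minv) -(mulmxA Dy1) Dy1M.
    rewrite normrM normfV mulrA; congr (_ * `|_| * _).
    rewrite [LHS]mxE [LHS]mxE [RHS]mxE.
    by apply: eq_bigr => l _; rewrite -ils_V_blockE.
  rewrite mulr_sumr [RHS]mxE; apply: eq_bigr => a _.
  by rewrite !absmxE -(mulmxA Dy1) Dy1M normrM normfV mulrA.
Qed.
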